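(* Let $\Delta,m \in \mathbb{Z}_{>0}$. (i) If $m \geq 5$, then \[ h(\Delta,m) \leq m^2 + m + 1 + 2\,(\Delta - 1) \cdot \sum_{i=0}^4 \binom{m}{i}, \] so in particular $h(\Delta,m) \in \mathcal{O}(m^4)\cdot \Delta$. (ii) If $m \geq 4$ and $\Delta$ is odd, then \[ h(\Delta,m) \leq m^2 + m + 1 + 2\,(\Delta - 1) \cdot \sum_{i=0}^3 \binom{m}{i}, \] so in particular $h(\Delta,m) \in \mathcal{O}(m^3)\cdot \Delta$ for odd $\Delta$.
   Context: For a real matrix $A \in \mathbb{R}^{m\times n}$ and $1 \le k \le \min\{m,n\}$, let $\Delta_k(A)$ denote the maximum of $|\det(B)|$ over all $k\times k$ submatrices $B$ of $A$. The generalized Heller constant $h(\Delta,m)$ is the maximum $n \in \mathbb{Z}_{>0}$ such that there exists an integer matrix $A \in \mathbb{Z}^{m\times n}$ with pairwise distinct columns and $\Delta_m(A) = \Delta$ (so $A$ has rank $m$). *)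

(* Defs.v *)
From mathcomp Require Import all_boot all_order all_algebra.
Set Implicit Arguments. Unset Strict Implicit. Unset Printing Implicit Defensive.
Import Order.TTheory GRing.Theory Num.Theory.

Definition strinc (k p : nat) (f : {ffun 'I_k -> 'I_p}) : bool :=
  [forall i : 'I_k, forall j : 'I_k, (i < j)%N ==> (f i < f j)%N].

(* Delta_k(A): maximum of |det B| over all k x k submatrices B of A
   (rows chosen by f, columns by g, both strictly increasing).
   The max over an empty family is 0. *)
Definition Delta_k (k m n : nat) (A : 'M[int]_(m, n)) : nat :=
  \max_(f : {ffun 'I_k -> 'I_m} | strinc f)
    \max_(g : {ffun 'I_k -> 'I_n} | strinc g)
      `|(\det (mxsub f g A))%R|%N.

Definition distinct_cols (m n : nat) (A : 'M[int]_(m, n)) : Prop :=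
  forall j1 j2 : 'I_n, col j1 A = col j2 A -> j1 = j2.

(* Main.v *)
Require Import Defs.
From mathcomp Require Import all_boot all_order all_algebra.
From mathcomp Require Import perm ring lra zify.
Set Implicit Arguments. Unset Strict Implicit. Unset Printing Implicit Defensive.
Import Order.TTheory GRing.Theory Num.Theory.

(* Let B be an m x m submatrix of A with |det B| = Delta.  The columns of A fall
   into at most Delta cosets of the lattice B Z^m, and in the coordinates
   Y = B^-1 A, which contain an identity block, all minors of all sizes are at
   most 1 in absolute value.  Within one coset, a row of Y either has entries in
   {-1, 0, 1} or takes only two values t and t - 1 with 0 < t < 1.  Record for
   each column the set of rows with entry positive or equal to -1: at most two
   columns share such a key, so by the Sauer-Shelah lemma it suffices that no
   5-set of rows (4-set if Delta is odd, as then t <> 1/2; 3-set for the trivial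
   coset) is shattered by the keys.  A shattered set would yield a minor
   exceeding 1: replacing the rows of a +-1 matrix of large determinant (48 for
   order 5, 16 for order 4) one by one by rows with entries t, t - 1 loses only
   a factor 2 per row.  One integral row can be treated in the same way, two
   integral rows need small explicit minors, and three integral rows are never
   shattered. *)

(** * The Sauer-Shelah lemma *)

Definition shattered (T : finType) (F : {set {set T}}) : {set {set T}} :=
  [set X : {set T} | [forall Z : {set T}, (Z \subset X) ==> [exists K in F, K :&: X == Z]]].

Lemma shatteredP (T : finType) (F : {set {set T}}) (X : {set T}) :
  reflect (forall Z : {set T}, Z \subset X -> exists2 K, K \in F & K :&: X = Z)
          (X \in shattered F).
Proof.
rewrite inE; apply: (iffP forallP) => H Z.
  by move=> ZX; have /exists_inP[K KF /eqP] := implyP (H Z) ZX; exists K.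
by apply/implyP=> /H[K KF KX]; apply/exists_inP; exists K => //; apply/eqP.
Qed.

Lemma shatteredS (T : finType) (F G : {set {set T}}) :
  F \subset G -> shattered F \subset shattered G.
Proof.
move=> /subsetP FG; apply/subsetP=> X /shatteredP H; apply/shatteredP=> Z /H[K KF KX].
by exists K => //; apply: FG.
Qed.

(* Pajor's strengthening of the Sauer-Shelah lemma. *)
Lemma card_shattered (T : finType) (F : {set {set T}}) : #|F| <= #|shattered F|.
Proof.
have [n] := ubnP #|F|; elim: n F => // n IH F; rewrite ltnS => Fn.
have [F1|F1] := leqP #|F| 1.
  have [->|/set0Pn[K KF]] := eqVneq F set0; first by rewrite cards0.
  apply: leq_trans F1 _; apply/card_gt0P; exists set0; apply/shatteredP=> Z.
  by rewrite subset0 => /eqP->; exists K; rewrite ?setI0.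
have /card_gt1P[K1 [K2 [K1F K2F K12]]] := F1.
have [x [L1 [L2 [L1F L2F xL1 xL2]]]] :
    exists x L1 L2, [/\ L1 \in F, L2 \in F, x \in L1 & x \notin L2].
  have [s12|/subsetPn[x]] := boolP (K1 \subset K2); last by exists x, K1, K2.
  have [s21|/subsetPn[x]] := boolP (K2 \subset K1); last by exists x, K2, K1.
  by move: K12; rewrite eqEsubset s12 s21.
(* Split by membership of [x]; the choice of [L1] and [L2] makes both halves smaller than [F]. A set
   shattered by either half avoids [x]. *)
pose Fin := F :&: [set K : {set T} | x \in K]; pose Fout := F :\: [set K : {set T} | x \in K].
have cF : #|F| = #|Fin| + #|Fout| by rewrite cardsID.
have Fin0 : 0 < #|Fin| by apply/card_gt0P; exists L1; rewrite !inE L1F.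
have Fout0 : 0 < #|Fout| by apply/card_gt0P; exists L2; rewrite !inE xL2.
have Ii := IH Fin ltac:(lia); have Io := IH Fout ltac:(lia).
have xin X : X \in shattered Fin -> x \notin X.
  move=> /shatteredP H; apply/negP=> xX; have [K] := H set0 (sub0set _).
  by rewrite !inE => /andP[_ xK] /setP/(_ x); rewrite !inE xK xX.
have xout X : X \in shattered Fout -> x \notin X.
  move=> /shatteredP H; apply/negP=> xX; have [K] := H X (subxx _).
  by rewrite !inE => /andP[xK _] /setP/(_ x); rewrite !inE xX (negPf xK).
pose Both := shattered Fin :&: shattered Fout.
have xB X : X \in Both -> x |: X \in shattered F.
  rewrite inE => /andP[hi ho]; have := hi; have := ho.
  move=> /shatteredP Ho /shatteredP Hi; apply/shatteredP=> Z ZX.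
  have ZxX : Z :\ x \subset X by rewrite subDset.
  have nxX := xin _ hi.
  have [xZ|xZ] := boolP (x \in Z).
    have [K] := Hi _ ZxX; rewrite !inE => /andP[KF xK] KX; exists K => //.
    by rewrite setIUr KX (setIidPr _) ?sub1set // setD1K.
  have [K] := Ho _ ZxX; rewrite !inE => /andP[xK KF] KX; exists K => //.
  rewrite setIUr KX disjoint_setI0 ?set0U; last by rewrite disjoint_sym disjoints1.
  by apply/setP=> y; rewrite !inE; case: eqP => // ->; rewrite (negPf xZ).
have cB : #|[set x |: X | X in Both]| = #|Both|.
  apply: card_in_imset => X Y /setIP[/xin nX _] /setIP[/xin nY _] E.
  by rewrite -(setU1K nX) E setU1K.
(* Sets shattered by both halves count twice in the induction bounds. Adding [x] to them supplies
   the missing second copies, which are new because they contain [x]. *)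
have dis : [disjoint (shattered Fin :|: shattered Fout) & [set x |: X | X in Both]].
  apply/pred0P=> X /=; apply/negbTE/negP => /andP[/setUP[/xin|/xout] nX];
  by case/imsetP=> Y _ EX; rewrite EX setU11 in nX.
have sub : (shattered Fin :|: shattered Fout) :|: [set x |: X | X in Both] \subset shattered F.
  rewrite !subUset !shatteredS ?subsetIl ?subsetDl //=.
  by apply/subsetP=> _ /imsetP[X XB ->]; apply: xB.
apply: leq_trans (subset_leq_card sub).
by rewrite cardsU (disjoint_setI0 dis) cards0 subn0 cB cF cardsUI leq_add.
Qed.

(** Subsets of shattered sets are shattered, so a shattered set with at least [d] elements would
    contain one of size exactly [d]. Hence every shattered set is smaller than [d]. *)
Lemma sauer_shelah (T : finType) (F : {set {set T}}) d :
  (forall X, X \in shattered F -> #|X| != d) ->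
  #|F| <= \sum_(i < d) 'C(#|T|, i).
Proof.
move=> H; apply: leq_trans (card_shattered F) _.
have small X : X \in shattered F -> #|X| < d.
  move=> XF; rewrite ltnNge; apply/negP=> dX.
  have [A [AX dA]] : exists A : {set T}, A \subset X /\ #|A| = d.
    by exists [set y in take d (enum X)]; split;
      [apply/subsetP=> y; rewrite inE => /mem_take; rewrite mem_enum
      | rewrite cardsE (card_uniqP (take_uniq _ (enum_uniq _))) size_takel -?cardE].
  have : A \in shattered F.
    move/shatteredP: XF => XF; apply/shatteredP=> Z ZA.
    have [K KF KX] := XF Z (subset_trans ZA AX); exists K => //.
    by rewrite -(setIidPr AX) setIA KX (setIidPl ZA).
  by move/H; rewrite dA eqxx.
case: d small {H} => [|d] small.
  by rewrite big_ord0 leqn0 cards_eq0 -subset0; apply/subsetP=> X /small.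
rewrite -[#|shattered F|]sum1_card.
rewrite (partition_big (fun X : {set T} => inord #|X| : 'I_d.+1) (fun=> true)) //=.
apply: leq_sum => i _; rewrite sum1dep_card -card_draws; apply/subset_leq_card/subsetP=> X.
by rewrite inE => /andP[/small Xd /eqP<-]; rewrite inE inordK.
Qed.

Local Open Scope ring_scope.

(** * Small and sign determinants *)

(** The index shift [bump], written with [Nat.leb] so that it evaluates on concrete numerals. *)
Definition skip (j l : nat) : nat := if Nat.leb j l then l.+1 else l.

(* Unlike the locked [\det], this reduces on concrete sizes, after which [ring] applies. *)
Fixpoint laplace (R : comNzRingType) (k : nat) (F : nat -> nat -> R) : R :=
  if k is k'.+1 then
    foldr (fun j acc =>
      (-1) ^+ j * F 0%N j * laplace k' (fun i l => F i.+1 (skip j l)) + acc)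
      0 (iota 0 k)
  else 1.

Lemma skipE j l : skip j l = bump j l.
Proof.
rewrite /skip /bump.
by case: PeanoNat.Nat.leb_spec0 => [/ssrnat.leP->|/ssrnat.leP/negPf->].
Qed.

Lemma det_laplace (R : comNzRingType) k (F : nat -> nat -> R) :
  \det (\matrix_(i < k, j < k) F i j) = laplace k F.
Proof.
elim: k F => [|k IH] F; first by rewrite det_mx00.
transitivity (\sum_(0 <= j < k.+1)
    (-1) ^+ j * F 0%N j * laplace k (fun i l => F i.+1 (skip j l))); last first.
  by rewrite unlock.
rewrite (expand_det_row _ ord0) big_mkord.
apply: eq_bigr => j _; rewrite mxE /cofactor add0n mulrCA mulrA; congr (_ * _).
rewrite -IH; congr (\det _); apply/matrixP => i l.
by rewrite !mxE skipE.
Qed.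

(** By linearity in row [i0] the determinant is a difference of two, so one of them has at least
    half its absolute value. *)
Lemma det_replace_row (R : realFieldType) p (M : 'M[R]_p) i0 (u v : 'I_p -> R) :
  (forall j, M i0 j = u j - v j) ->
  exists2 w, (w = u \/ w = v) &
    `|\det M| <= 2 * `|\det (\matrix_(i, j) (if i == i0 then w j else M i j))|.
Proof.
move=> Muv; pose N w := \matrix_(i, j) (if i == i0 then w j else M i j).
have E : \det M = \det (N u) - \det (N v).
  rewrite -[\det (N u)]mul1r -mulN1r; apply: (determinant_multilinear (i0 := i0)).
  - by apply/rowP=> j; rewrite !mxE eqxx Muv mul1r mulN1r.
  - by apply/matrixP=> i j; rewrite !mxE [_ == i0]eq_sym (negPf (neq_lift _ _)).
  - by apply/matrixP=> i j; rewrite !mxE [_ == i0]eq_sym (negPf (neq_lift _ _)).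
have := ler_normB (\det (N u)) (\det (N v)); rewrite -E => D.
case: (lerP `|\det (N v)| `|\det (N u)|) => h.
  by exists u; [left | rewrite -/(N u); lra].
by exists v; [right | rewrite -/(N v); lra].
Qed.

(** The matrix is the all-ones matrix minus twice the identity, with eigenvalues 3 (once) and -2
    (four times). *)
Lemma det_sign_matrix5 (R : comNzRingType) :
  \det (\matrix_(i < 5, j < 5) (if Nat.eqb i j then -1 else 1 : R)) = 48%:R.
Proof.
rewrite (det_laplace _ (fun i j => if Nat.eqb i j then -1 else 1)) /=. ring.
Qed.

Definition sgn (R : realFieldType) (x : R) := x = 1 \/ x = -1.

Lemma sgnM (R : realFieldType) (x y : R) : sgn x -> sgn y -> sgn (x * y).
Proof. by rewrite /sgn => -[->|->] -[->|->]; rewrite ?mulN1r ?opprK ?mul1r; auto. Qed.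

Lemma sgn_eq (R : realFieldType) (x y : R) : sgn x -> sgn y -> `|x - y| <= 1 -> x = y.
Proof. by move=> [->|->] [->|->] //; rewrite ler_norml => /andP[]; lra. Qed.

Lemma sgn_eq_scaled (R : realFieldType) (x y s : R) : sgn x -> sgn y ->
  s < - 2^-1 \/ 2^-1 < s -> `|x * s - y * s| <= 1 -> x = y.
Proof.
by move=> [->|->] [->|->] //; rewrite ler_norml => -[] ? /andP[? ?]; lra.
Qed.

Lemma sgnN (R : realFieldType) (x : R) : sgn x -> sgn (- x).
Proof. by rewrite /sgn => -[->|->]; rewrite ?opprK; auto. Qed.

Lemma sgn_neq0 (R : realFieldType) (x : R) : sgn x -> x != 0.
Proof. by case=> ->; rewrite ?oppr_eq0 oner_eq0. Qed.

(** * Bounded minors: sets with two or three integral rows *)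

Section Core.
Variables (R : realFieldType) (m n : nat) (Y : 'M[R]_(m, n)) (J : {set 'I_n}).

(** Index maps are arbitrary: repetitions give minor 0 and reordering changes only the sign. *)
Definition minors_le1 := forall k (f : 'I_k -> 'I_m) (g : 'I_k -> 'I_n),
  `|\det (mxsub f g Y)| <= 1.

(* For entries in {-1, 0, 1} this is the residue modulo 2; for entries t, t - 1
   with 0 < t < 1 it tells the two values apart. *)
Definition bit (x : R) : bool := (0 < x) || (x == -1).

Definition int_row i := forall j, j \in J ->
  if bit (Y i j) then sgn (Y i j) else Y i j = 0.

Definition frac_row t i := 0 < t < 1 /\
  forall j, j \in J -> Y i j = if bit (Y i j) then t else t - 1.

Definition full_on (s : seq 'I_m) := forall b : seq bool, size b = size s ->
  exists2 j, j \in J & [seq bit (Y i j) | i <- s] = b.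

Hypothesis Y1 : minors_le1.

Lemma minor_le1 k (r : seq 'I_m) (c : seq 'I_n) r0 c0 :
  `|laplace k (fun i j => Y (nth r0 r i) (nth c0 c j))| <= 1.
Proof.
rewrite -det_laplace; have := Y1 (fun i : 'I_k => nth r0 r i) (fun j : 'I_k => nth c0 c j).
by congr (`|\det _| <= 1); apply/matrixP=> i j; rewrite !mxE.
Qed.

Lemma minor2_le1 a b x y : `|Y a x * Y b y - Y a y * Y b x| <= 1.
Proof.
have := minor_le1 2 [:: a; b] [:: x; y] a x.
by congr (`|_| <= 1); rewrite /=; ring.
Qed.

Lemma full_onP p (f : 'I_p -> 'I_m) (b : 'I_p -> 'I_p -> bool) :
  full_on (codom f) ->
  exists g : 'I_p -> 'I_n, forall j, g j \in J /\ forall i, bit (Y (f i) (g j)) = b i j.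
Proof.
move=> H; suff : forall j, exists k, k \in J /\ forall i, bit (Y (f i) k) = b i j.
  by move/fin_all_exists.
move=> j; have [|k kJ] := H [seq b i j | i <- enum 'I_p]; first by rewrite !size_map.
rewrite /codom /image_mem -map_comp => /eq_in_map E.
by exists k; split=> // i; apply: (E i); rewrite mem_enum.
Qed.

(** After scaling the rows by the entries of [w], the 2 x 2 minors make each of [x], [y], [z]
    constant on its two-row support, and then their 3 x 3 minor is +-2. Only nonempty patterns are
    demanded, so that the empty set may be added to the keys. *)
Lemma full_on_int3 a b c :
  (forall d, size d = 3 -> has id d ->
     exists2 j, j \in J & [seq bit (Y i j) | i <- [:: a; b; c]] = d) ->
  int_row a -> int_row b -> int_row c -> False.
Proof.
move=> H Ia Ib Ic.
have [x xJ [xa xb xc]] := H [:: true; true; false] erefl isT.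
have [y yJ [ya yb yc]] := H [:: true; false; true] erefl isT.
have [z zJ [za zb zc]] := H [:: false; true; true] erefl isT.
have [w wJ [wa wb wc]] := H [:: true; true; true] erefl isT.
have := Ia _ xJ; have := Ib _ xJ; have := Ic _ xJ; rewrite xa xb xc => Exc Exb Exa.
have := Ia _ yJ; have := Ib _ yJ; have := Ic _ yJ; rewrite ya yb yc => Eyc Eyb Eya.
have := Ia _ zJ; have := Ib _ zJ; have := Ic _ zJ; rewrite za zb zc => Ezc Ezb Eza.
have := Ia _ wJ; have := Ib _ wJ; have := Ic _ wJ; rewrite wa wb wc => Ewc Ewb Ewa.
have D : `|Y a x * Y b z * Y c y - - (Y b x * Y a y * Y c z)| <= 1.
  have := minor_le1 3 [:: a; b; c] [:: x; y; z] a x.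
  by rewrite -normrN; congr (`|_| <= 1); rewrite /= Exc Eyb Eza; ring.
have {}D : Y a x * Y b z * Y c y = - (Y b x * Y a y * Y c z).
  exact: sgn_eq (sgnM (sgnM Exa Ezb) Eyc) (sgnN (sgnM (sgnM Exb Eya) Ezc)) D.
have Dab : Y a x * Y b w = Y a w * Y b x.
  exact: sgn_eq (sgnM Exa Ewb) (sgnM Ewa Exb) (minor2_le1 _ _ _ _).
have Dac : Y a y * Y c w = Y a w * Y c y.
  exact: sgn_eq (sgnM Eya Ewc) (sgnM Ewa Eyc) (minor2_le1 _ _ _ _).
have Dbc : Y b z * Y c w = Y b w * Y c z.
  exact: sgn_eq (sgnM Ezb Ewc) (sgnM Ewb Ezc) (minor2_le1 _ _ _ _).
pose P := Y a x * Y b z * Y c y.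
have /sgn_neq0/eqP[] := sgnM (sgnM (sgnM Exa Ezb) Eyc) (sgnM (sgnM Ewa Ewb) Ewc).
rewrite -/P; have : P * (Y a w * Y b w * Y c w) = - (P * (Y a w * Y b w * Y c w)).
  transitivity ((Y a x * Y b w) * (Y b z * Y c w) * (Y a w * Y c y)).
    by rewrite /P; ring.
  by rewrite Dab Dbc -Dac /P D; ring.
by clear; lra.
Qed.

Lemma full_on_int2_frac2 u v r1 r2 t1 t2 : full_on [:: u; v; r1; r2] ->
  int_row u -> int_row v -> frac_row t1 r1 -> frac_row t2 r2 -> t1 = 2^-1.
Proof.
move=> H Iu Iv [t1b F1] [t2b F2]; apply/eqP/negPn/negP => t1n.
have t1n' : t1 < 2^-1 \/ 2^-1 < t1 by case: ltgtP t1n => //; [left|right].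
(* As [t1] differs from 1/2, one of its two values, [s], exceeds 1/2 in absolute value. All four
   columns below take the value [s] in row [r1]. *)
pose c := 2^-1 < t1; pose s := if c then t1 else t1 - 1.
have sb : s < - 2^-1 \/ 2^-1 < s.
  by rewrite /s /c; case: (ltP 2^-1 t1) => h; [right|left; case: t1n' => ?; lra].
have [x xJ [xu xv x1 x2]] := H [:: true; false; c; true] erefl.
have [y yJ [yu yv y1 y2]] := H [:: false; true; c; true] erefl.
have [z zJ [zu zv z1 z2]] := H [:: true; true; c; false] erefl.
have [o oJ [ou ov o1 o2]] := H [:: false; false; c; false] erefl.
have := F1 _ xJ; have := F1 _ yJ; have := F1 _ zJ; have := F1 _ oJ.
have := F2 _ xJ; have := F2 _ yJ; have := F2 _ zJ; have := F2 _ oJ.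
have := Iu _ xJ; have := Iu _ yJ; have := Iu _ zJ; have := Iu _ oJ.
have := Iv _ xJ; have := Iv _ yJ; have := Iv _ zJ; have := Iv _ oJ.
rewrite xu xv x1 x2 yu yv y1 y2 zu zv z1 z2 ou ov o1 o2 -/s.
move=> vo vz vy vx uo uz uy ux o2' z2' y2' x2' o1' z1' y1' x1'.
have Eu : Y u x = Y u z.
  by apply: (sgn_eq_scaled ux uz sb); have := minor2_le1 u r1 x z; rewrite x1' z1'.
have Ev : Y v y = Y v z.
  by apply: (sgn_eq_scaled vy vz sb); have := minor2_le1 v r1 y z; rewrite y1' z1'.
(* Once signs agree, x + y - z - o vanishes outside row [r2], where it equals 2. The 4 x 4 minor is
   therefore +-2s. *)
have : `|Y u z * Y v z * (2 * s)| <= 1.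
  have := minor_le1 4 [:: u; v; r1; r2] [:: x; y; z; o] u x.
  congr (`|_| <= 1).
  by rewrite /= vo uo uy vx o2' z2' y2' x2' o1' z1' y1' x1' Eu Ev; ring.
rewrite ler_norml; clear -uz vz sb => /andP[].
clearbody s; by case: uz => ->; case: vz => ->; case: sb; lra.
Qed.
End Core.

(** The planar determinant of the vectors p - p' and q. *)
Definition cross (R : realFieldType) (p p' q : R * R) := (p.1 - p'.1) * q.2 - (p.2 - p'.2) * q.1.

(* Three sign vectors x = (+-1, 0), y = (0, +-1), z = (+-1, +-1) satisfy, up to
   sign, x + y = z, y + z = x, x + z = y or x + y + z = 0.  The last case is
   excluded by [T], and the others by [Dz], [Dx] and [Dy] respectively. *)
Lemma sign_pattern_clash (R : realFieldType) (x1 y2 z1 z2 bx by_ bz1 bz2 cx cy cz1 cz2 : R) :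
  let x := (x1, 0) in let y := (0, y2) in let z := (z1, z2) in
  sgn x1 -> sgn y2 -> sgn z1 -> sgn z2 ->
  sgn bx -> sgn by_ -> sgn bz1 -> sgn bz2 ->
  sgn cx -> sgn cy -> sgn cz1 -> sgn cz2 ->
  z1 * bz2 = bz1 * z2 -> z1 * cz2 = cz1 * z2 ->
  forall (Dx : sgn (cross y z y) -> sgn (cross y z (bx, 0) / 2) ->
               sgn (cross y z (cx, 0) / 2) -> False)
    (Dy : sgn (cross x z x) -> sgn (cross x z (0, by_) / 2) ->
          sgn (cross x z (0, cy) / 2) -> False)
    (Dz : sgn (cross x y x) -> sgn (cross x y (bz1, bz2) / 2) ->
          sgn (cross x y (cz1, cz2) / 2) -> False)
    (T : `|((y.1 - x.1) * (z.2 - x.2) - (y.2 - x.2) * (z.1 - x.1)) / 2| <= 1),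
  False.
Proof.
rewrite /cross /= => S1 S2 S3 S4 B1 B2 B3 B4 C1 C2 C3 C4 Zb Zc Dx Dy Dz T.
case: S1 S2 S3 S4 => -> [] -> [] -> [] -> in Zb Zc Dx Dy Dz T *;
  first
    [ by move: T; rewrite ler_norml => /andP[]; clear; lra
    | apply: Dx; clear -B1 C1; first (by [left; lra | right; lra]);
        [case: B1 | case: C1] => ->; by [left; lra | right; lra]
    | apply: Dy; clear -B2 C2; first (by [left; lra | right; lra]);
        [case: B2 | case: C2] => ->; by [left; lra | right; lra]
    | apply: Dz; clear -B3 B4 C3 C4 Zb Zc; first (by [left; lra | right; lra]);
        [ case: B3 B4 => -> [] -> in Zb *
        | case: C3 C4 => -> [] -> in Zc *]; by [left; lra | right; lra] ].
Qed.

Lemma codom_nth (T : Type) (x : T) (s : seq T) p :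
  size s = p -> codom (fun i : 'I_p => nth x s i) = s.
Proof.
move=> <-; rewrite /codom /image_mem -[RHS](mkseq_nth x) /mkseq -val_enum_ord -map_comp.
exact: eq_map.
Qed.

(** * Half-integral rows and the box argument *)

Section Core.
Variables (R : realFieldType) (m n : nat) (Y : 'M[R]_(m, n)) (J : {set 'I_n}).
Hypothesis Y1 : minors_le1 Y.
Notation full_on := (full_on Y J).
Notation int_row := (int_row Y J).
Notation frac_row := (frac_row Y J).

Lemma full_on_int2_half3 u v r1 r2 r3 : full_on [:: u; v; r1; r2; r3] ->
  int_row u -> int_row v ->
  frac_row 2^-1 r1 -> frac_row 2^-1 r2 -> frac_row 2^-1 r3 -> False.
Proof.
move=> H Iu Iv [_ F1] [_ F2] [_ F3].
have pick bu bv b2 b3 : exists j,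
    [/\ if bu then sgn (Y u j) else Y u j = 0, if bv then sgn (Y v j) else Y v j = 0,
        Y r1 j = 2^-1, Y r2 j = (if b2 then 2^-1 else 2^-1 - 1) &
        Y r3 j = (if b3 then 2^-1 else 2^-1 - 1)].
  have [j jJ [ju jv j1 j2 j3]] := H [:: bu; bv; true; b2; b3] erefl.
  exists j; split.
  - by have := Iu _ jJ; rewrite ju.
  - by have := Iv _ jJ; rewrite jv.
  - by have := F1 _ jJ; rewrite j1.
  - by have := F2 _ jJ; rewrite j2.
  - by have := F3 _ jJ; rewrite j3.
(* A prefix [b] or [c] marks the value -1/2 in [r3] or [r2]; plain [o] has it in both. The last
   letter [x], [y], [z], [o] gives the support on the integral rows: [u], [v], both, none. *)
have [x [xu xv x1 x2 x3]] := pick true false true true.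
have [y [yu yv y1 y2 y3]] := pick false true true true.
have [z [zu zv z1 z2 z3]] := pick true true true true.
have [o [ou ov o1 o2 o3]] := pick false false false false.
have [bo [bou bov bo1 bo2 bo3]] := pick false false true false.
have [bx [bxu bxv bx1 bx2 bx3]] := pick true false true false.
have [by_ [byu byv by1 by2 by3]] := pick false true true false.
have [bz [bzu bzv bz1 bz2 bz3]] := pick true true true false.
have [co [cou cov co1 co2 co3]] := pick false false false true.
have [cx [cxu cxv cx1 cx2 cx3]] := pick true false false true.
have [cy [cyu cyv cy1 cy2 cy3]] := pick false true false true.
have [cz [czu czv cz1 cz2 cz3]] := pick true true false true.
pose P j := (Y u j, Y v j); pose cr p p' q := cross (P p) (P p') (P q).
(* The four half-integral classes satisfy a - b - c + o = 0, so the 5 x 5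
   minor collapses to a planar determinant. *)
have D p p' q q' : [/\ Y r1 p = 2^-1, Y r2 p = 2^-1 & Y r3 p = 2^-1] ->
    [/\ Y r1 p' = 2^-1, Y r2 p' = 2^-1 & Y r3 p' = 2^-1] ->
    [/\ Y r1 q = 2^-1, Y r2 q = 2^-1 & Y r3 q = 2^-1 - 1] ->
    [/\ Y r1 q' = 2^-1, Y r2 q' = 2^-1 - 1 & Y r3 q' = 2^-1] ->
    `|cr p p' p - cr p p' q - cr p p' q'| <= 2.
  move=> [p1 p2 p3] [p1' p2' p3'] [q1 q2 q3] [q1' q2' q3'].
  have := minor_le1 Y1 5 [:: u; v; r1; r2; r3] [:: p; p'; q; q'; o] u x.
  have -> : laplace 5 (fun i j => Y (nth u [:: u; v; r1; r2; r3] i)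
                                    (nth x [:: p; p'; q; q'; o] j))
      = (cr p p' p - cr p p' q - cr p p' q') / 2.
    by rewrite /= ou ov o1 o2 o3 p1 p2 p3 p1' p2' p3' q1 q2 q3 q1' q2' q3' /cr /cross /=; field.
  by rewrite normrM (@gtr0_norm _ 2^-1) ?invr_gt0 // ler_pdivrMr // mul1r.
(* Since [bo] and [co] vanish on [u] and [v], using them drops one term. With e = +-1 and f, f' =
   +-2, the bounds |e - f| <= 2 and |e - f'| <= 2 force f = f' = 2e, but then |e - f - f'| = 3. *)
have {}D p p' q q' : [/\ Y r1 p = 2^-1, Y r2 p = 2^-1 & Y r3 p = 2^-1] ->
    [/\ Y r1 p' = 2^-1, Y r2 p' = 2^-1 & Y r3 p' = 2^-1] ->
    [/\ Y r1 q = 2^-1, Y r2 q = 2^-1 & Y r3 q = 2^-1 - 1] ->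
    [/\ Y r1 q' = 2^-1, Y r2 q' = 2^-1 - 1 & Y r3 q' = 2^-1] ->
    sgn (cr p p' p) -> sgn (cr p p' q / 2) -> sgn (cr p p' q' / 2) -> False.
  move=> Hp Hp' Hq Hq'.
  have crb : cr p p' bo = 0 by rewrite /cr /cross /= bou bov; ring.
  have crc : cr p p' co = 0 by rewrite /cr /cross /= cou cov; ring.
  have := D p p' q co Hp Hp' Hq (And3 co1 co2 co3).
  have := D p p' bo q' Hp Hp' (And3 bo1 bo2 bo3) Hq'.
  have := D p p' q q' Hp Hp' Hq Hq'; rewrite crb crc !subr0 !ler_norml.
  move: (cr p p' p) (cr p p' q) (cr p p' q') => e f f'; clear.
  by move=> d3 d2 d1 [] he [] hf [] hf'; lra.
have Zb : Y u z * Y v bz = Y u bz * Y v z.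
  exact: sgn_eq (sgnM zu bzv) (sgnM bzu zv) (minor2_le1 Y1 _ _ _ _).
have Zc : Y u z * Y v cz = Y u cz * Y v z.
  exact: sgn_eq (sgnM zu czv) (sgnM czu zv) (minor2_le1 Y1 _ _ _ _).
have T : `|((Y u y - Y u x) * (Y v z - Y v x) - (Y v y - Y v x) * (Y u z - Y u x)) / 2| <= 1.
  have := minor_le1 Y1 3 [:: u; v; r1] [:: x; y; z] u x.
  by congr (`|_| <= 1); rewrite /= x1 y1 z1; ring.
have Hx := And3 x1 x2 x3; have Hy := And3 y1 y2 y3; have Hz := And3 z1 z2 z3.
have := D x y bz cz Hx Hy (And3 bz1 bz2 bz3) (And3 cz1 cz2 cz3).
have := D y z bx cx Hy Hz (And3 bx1 bx2 bx3) (And3 cx1 cx2 cx3).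
have := D x z by_ cy Hx Hz (And3 by1 by2 by3) (And3 cy1 cy2 cy3).
rewrite /cr /P xv yu bxv byu cxv cyu => Dy Dx Dz.
by apply: (sign_pattern_clash xu yv zu zv bxu byv bzu bzv cxu cyv czu czv Zb Zc Dx Dy Dz); move: T; rewrite xv yu.
Qed.

(* A sign row is the difference of two rows with entries in the box, so one of
   them retains at least half of the determinant.  An integral row [i0] must be
   replaced last, since the signs of its nonzero entries depend on the choices
   made in the other rows. *)
Lemma det_box p (f : 'I_p -> 'I_m) (t : 'I_p -> R) i0 : full_on (codom f) ->
  (forall i, i != i0 -> frac_row (t i) (f i)) ->
  int_row (f i0) \/ frac_row (t i0) (f i0) ->
  forall s (M : 'M_p), uniq s -> i0 \notin s ->
  (forall i j, i \in i0 :: s -> sgn (M i j)) ->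
  (forall i j, i \notin i0 :: s -> M i j = t i \/ M i j = t i - 1) ->
  `|\det M| <= 2 ^+ (size s).+1.
Proof.
move=> H Ff F0; elim=> [|i s IH] M.
  move=> _ _ Ms Mb.
  (* Both [g0] and [g1] realise [M] on the rows other than [i0]; in row [i0] they have bit false and
     true. Their entries there differ by a sign, whether that row is integral or fractional. *)
  have [g0 g0P] := full_onP (fun i j => (i != i0) && (M i j == t i)) H.
  have [g1 g1P] := full_onP (fun i j => (i == i0) || (M i j == t i)) H.
  have dist j : sgn (Y (f i0) (g1 j) - Y (f i0) (g0 j)).
    have [J0 /(_ i0) b0] := g0P j; have [J1 /(_ i0) b1] := g1P j.
    rewrite eqxx /= in b0 b1.
    case: F0 => [I|[_ F]]; [have := I _ J0; have := I _ J1 | have := F _ J0; have := F _ J1].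
      by rewrite b0 b1 => S ->; rewrite subr0.
    by rewrite b0 b1 => -> ->; left; ring.
  (* Since [M i0 j] is [e j] or its negative, it is a difference of the two entries in a suitable
     order. *)
  pose e j := Y (f i0) (g1 j) - Y (f i0) (g0 j).
  pose u b j := if (M i0 j == e j) == b then Y (f i0) (g1 j) else Y (f i0) (g0 j).
  have Mi0 j : M i0 j = u true j - u false j.
    rewrite /u eqb_id eqbF_neg; case: (M i0 j =P e j) => [->//|/eqP /=].
    have := dist j; rewrite -[X in _ -> _ -> _ = X]opprB -/(e j).
    have := Ms i0 j (mem_head _ _).
    by move=> [->|->] [->|->]; rewrite ?opprK ?eqxx.
  have [w w_uv] := det_replace_row Mi0.
  have [b -> {w w_uv}] : exists b, w = u b by case: w_uv; eexists; eassumption.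
  move/le_trans; apply; rewrite expr1 -[leRHS]mulr1 ler_pM2l //.
  pose g j := if (M i0 j == e j) == b then g1 j else g0 j.
  have -> : \matrix_(i, j) (if i == i0 then u b j else M i j) = mxsub f g Y.
    apply/matrixP=> i j; rewrite !mxE /g /u; case: eqP => [->|/eqP ni]; first by case: ifP.
    have [_ F] := Ff _ ni.
    have M01 : M i j = if M i j == t i then t i else t i - 1.
      by have [||->] := Mb i j; rewrite ?inE //; case: eqP.
    have [J0 /(_ i) b0] := g0P j; have [J1 /(_ i) b1] := g1P j.
    rewrite ni (negPf ni) /= in b0 b1.
    by case: ifP => _; rewrite F // ?b0 ?b1.
  exact: Y1.
rewrite inE negb_or => /andP[ns us] /andP[ni0 i0s] Ms Mb.
(* A sign is the difference of [t i] and [t i - 1] in one of the two orders. *)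
pose u b j := if (M i j == 1) == b then t i else t i - 1.
have Mi j : M i j = u true j - u false j.
  have := Ms i j; rewrite !inE eqxx orbT => /(_ isT); rewrite /u.
  have n11 : (-1 == 1 :> R) = false by apply/eqP; lra.
  by case=> ->; rewrite ?eqxx ?n11 /=; ring.
have [w w_uv] := det_replace_row Mi.
have [b -> {w w_uv}] : exists b, w = u b by case: w_uv; eexists; eassumption.
move/le_trans; apply; rewrite exprS ler_pM2l //; apply: IH => //.
  move=> k j ks; rewrite mxE; case: eqP => [ki|_].
    by move: ks; rewrite inE ki eq_sym (negPf ni0) (negPf ns).
  by apply: Ms; move: ks; rewrite !inE => /orP[->|->]; rewrite ?orbT.
move=> k j ks; rewrite mxE; case: eqP => [->|/eqP ki].
  by rewrite /u; case: ifP; auto.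
by apply: Mb; move: ks; rewrite !inE (negPf ki).
Qed.

(** All five rows of the sign matrix are replaced, the possibly integral one last, which gives 48 <=
    2^5, a contradiction. *)
Lemma full_on_frac4 a s : size s = 4 -> full_on (a :: s) ->
  int_row a \/ (exists t, frac_row t a) ->
  (forall i, i \in s -> exists t, frac_row t i) -> False.
Proof.
move=> s4 H Ra Rs; pose f (i : 'I_5) := nth a (a :: s) i.
have Ef : codom f = a :: s by apply: codom_nth; rewrite /= s4.
have [t tP] : exists t : 'I_5 -> R, forall i, (i != ord0 -> frac_row (t i) (f i)) /\
    (i = ord0 -> int_row (f i) \/ frac_row (t i) (f i)).
  suff : forall i, exists t, (i != ord0 -> frac_row t (f i)) /\
      (i = ord0 -> int_row (f i) \/ frac_row t (f i)) by move/fin_all_exists.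
  move=> i; case: (unliftP ord0 i) => [k|] ->.
    have [|t ?] := Rs (f (lift ord0 k)); first by rewrite /f lift0 /= mem_nth ?s4.
    by exists t; split.
  case: Ra => [I|[t F]]; first by exists 0; split=> // _; left.
  by exists t; split=> // _; right.
pose r := [seq lift ord0 i | i <- enum 'I_4].
have rP i : i \in (ord0 : 'I_5) :: r.
  rewrite inE; case: (unliftP ord0 i) => [k|] ->; rewrite ?eqxx //.
  by rewrite map_f ?mem_enum ?orbT.
rewrite -Ef in H.
have := det_box H (fun i => (tP i).1) ((tP ord0).2 erefl)
  (s := r) (M := \matrix_(i < 5, j < 5) (if Nat.eqb i j then -1 else 1)).
rewrite det_sign_matrix5 size_map size_enum_ord => B.
have : `|48%:R : R| <= 2 ^+ 5.
  apply: B.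
  - by rewrite map_inj_uniq ?enum_uniq //; apply: lift_inj.
  - by apply/mapP=> -[k _] /eqP; rewrite (negPf (neq_lift _ _)).
  - by move=> i j _; rewrite mxE; case: ifP; [right|left].
  - by move=> i j; rewrite rP.
by rewrite normr_nat -natrX ler_nat.
Qed.

(** Row [b] is kept constant at x, equal to t or t - 1, and three sign rows are replaced. Then |16x|
    <= 2^3 for both values, which leaves only t = 1/2. *)
Lemma full_on_frac3 a b s t : size s = 2 -> full_on [:: a, b & s] ->
  int_row a \/ (exists t, frac_row t a) -> frac_row t b ->
  (forall i, i \in s -> exists t, frac_row t i) -> t = 2^-1.
Proof.
case: s => [|c [|d []]] // _ H Ra Fb Rs; pose f (i : 'I_4) := nth a [:: a; b; c; d] i.
have Ef : codom f = [:: a; b; c; d] by apply: codom_nth.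
have [tc Fc] : exists t, frac_row t c by apply: Rs; rewrite inE eqxx.
have [td Fd] : exists t, frac_row t d by apply: Rs; rewrite !inE eqxx orbT.
have [ta Fa] : exists ta, int_row a \/ frac_row ta a.
  by case: Ra => [|[ta]] ?; [exists 0; left | exists ta; right].
pose tt (i : 'I_4) := nth 0 [:: ta; t; tc; td] i.
rewrite -Ef in H.
pose r : seq 'I_4 := [:: inord 2; inord 3].
have Ff i : i != ord0 -> frac_row (tt i) (f i) by case: i => [[|[|[|[|?]]]] ?].
have B x : x = t \/ x = t - 1 -> `|16%:R * x| <= 8%:R.
  (* With x = 1 this is a Hadamard matrix of order 4. *)
  move=> Hx; pose F i j : R := nth 0 (nth [::] [:: [:: -1; -1; 1; 1];
     [:: x; x; x; x]; [:: 1; -1; -1; 1]; [:: 1; -1; 1; -1]] i) j.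
  have <- : \det (\matrix_(i < 4, j < 4) F i j) = 16%:R * x.
    by rewrite det_laplace /F /=; ring.
  have -> : 8%:R = 2 ^+ (size r).+1 :> R by rewrite -natrX.
  apply: (det_box H Ff (i0 := ord0)) => //.
  - by rewrite /= andbT inE -val_eqE /= !inordK.
  - by rewrite !inE -!val_eqE /= !inordK.
  - move=> i j; rewrite !mxE !inE -!val_eqE /= !inordK //.
    by case: i j => [[|[|[|[|?]]]] ?] [[|[|[|[|?]]]] ?] //= _; rewrite /F /=; by [left | right].
  - move=> i j; rewrite !mxE !inE -!val_eqE /= !inordK //.
    by case: i j => [[|[|[|[|?]]]] ?] [[|[|[|[|?]]]] ?].
have := B t (or_introl erefl); have := B (t - 1) (or_intror erefl).
by rewrite !ler_norml; lra.
Qed.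
End Core.

(** * Columns within one coset *)

Section Class.
Variables (R : realFieldType) (m n : nat) (Y : 'M[R]_(m, n)) (J : {set 'I_n}).
Hypothesis Y1 : minors_le1 Y.
Notation full_on := (full_on Y J).
Notation int_row := (int_row Y J).
Notation frac_row := (frac_row Y J).

Definition key j : {set 'I_m} := [set i | bit (Y i j)].

Lemma shattered_full_on (F : {set {set 'I_m}}) X s (b : seq bool) :
  X \in shattered F -> uniq s -> {subset s <= X} -> size b = size s ->
  exists2 K, K \in F & [seq i \in K | i <- s] = b.
Proof.
move=> /shatteredP H us sX bs.
pose Z := [set i in X | nth false b (index i s)].
have [|K KF KX] := H Z; first by apply/subsetP=> i; rewrite inE => /andP[].
exists K => //; apply: (@eq_from_nth _ false); rewrite size_map // => i iS.
have x0 : 'I_m by case: s iS {us sX bs Z KX}.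
rewrite (nth_map x0) //; have /setP/(_ (nth x0 s i)) := KX.
by rewrite !inE sX ?mem_nth // andbT index_uniq // => ->.
Qed.

Lemma shattered_key_full_on X s :
  X \in shattered (key @: J) -> uniq s -> {subset s <= X} -> full_on s.
Proof.
move=> H us sX b bs; have [_ /imsetP[j jJ ->] <-] := shattered_full_on H us sX bs.
by exists j => //; apply: eq_map => i; rewrite inE.
Qed.

Hypothesis rows : forall i, int_row i \/ exists t, frac_row t i.
Hypothesis dist : forall j k, j \in J -> k \in J -> (forall i, Y i j = Y i k) -> j = k.

(** Equal keys mean equal entries on fractional rows and equality up to sign on integral rows. A 2 x
    2 minor carries a sign change in one integral row to every other. *)
Lemma key_eq j k : j \in J -> k \in J -> key j = key k ->
  j = k \/ (forall i, int_row i -> Y i k = - Y i j).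
Proof.
move=> jJ kJ E; have eb i : bit (Y i j) = bit (Y i k).
  by have /setP/(_ i) := E; rewrite !inE.
have [/forallP h|] := boolP [forall i, Y i j == Y i k].
  by left; apply: dist => // i; apply/eqP.
rewrite negb_forall => /existsP[i ni]; right=> l Il.
have Ii : int_row i.
  case: (rows i) => [Ii|[t [_ F]]]; first exact: Ii.
  by rewrite (F _ jJ) (F _ kJ) eb eqxx in ni.
have := Ii _ jJ; have := Ii _ kJ; rewrite -eb; case: ifP => [bi Sik Sij|_ zk zj]; last first.
  by rewrite zk zj eqxx in ni.
have Ei : Y i k = - Y i j.
  by case: Sij Sik ni => -> [] ->; rewrite ?opprK ?eqxx.
have := Il _ jJ; have := Il _ kJ; rewrite -eb.
case: ifP => [bl Sk Sj|_ -> ->]; last by rewrite oppr0.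
have := sgn_eq (sgnM Sij Sk) (sgnM Sik Sj) (minor2_le1 Y1 i l j k).
rewrite Ei mulNr => H; apply: (mulfI (sgn_neq0 Sij)); rewrite H mulrN //.
Qed.

(** Two further columns with the key of [x] would both be its negative on integral rows, hence equal
    to each other. *)
Lemma key_fiber K : (#|[set j in J | key j == K]| <= 2)%N.
Proof.
rewrite leqNgt; apply/negP=> /card_gt2P[x [y [z []]]].
rewrite !inE => -[/andP[xJ /eqP kx] /andP[yJ /eqP ky] /andP[zJ /eqP kz]].
move=> [/eqP xy /eqP yz /eqP zx].
have [//|ex] := key_eq xJ yJ (etrans kx (esym ky)).
have [/esym//|ez] := key_eq xJ zJ (etrans kx (esym kz)).
apply: yz; apply: dist => // i; case: (rows i) => [Ii|[t [_ F]]].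
  by rewrite ex // ez.
by have /setP/(_ i) := etrans ky (esym kz); rewrite !inE => e; rewrite (F _ yJ) (F _ zJ) e.
Qed.

Lemma card_le_keys : (#|J| <= 2 * #|key @: J|)%N.
Proof.
rewrite -[#|J|]sum1_card (partition_big_imset key) /= mulnC -sum_nat_const.
by apply: leq_sum => K _; rewrite sum1dep_card key_fiber.
Qed.

(** When all rows are integral, only the zero column has the empty key. The fiber of [set0] thus has
    at most one column, which saves one. *)
Lemma card_le_keys_int : (forall i, int_row i) -> (#|J| < 2 * #|set0 |: key @: J|)%N.
Proof.
move=> I; have [K0|K0] := boolP (set0 \in key @: J); last first.
  by have := card_le_keys; rewrite cardsU1 K0; lia.
rewrite (setUidPr _) ?sub1set // -[#|J|]sum1_card (partition_big_imset key) /=.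
rewrite (bigD1 set0) //= sum1dep_card.
have z1 : (#|[set j in J | key j == set0]| <= 1)%N.
  rewrite leqNgt; apply/negP=> /card_gt1P[x [y []]].
  rewrite !inE => /andP[xJ /eqP kx] /andP[yJ /eqP ky] /eqP; apply.
  apply: dist => // i; have := I i _ xJ; have := I i _ yJ.
  have /setP/(_ i) := kx; have /setP/(_ i) := ky; rewrite !inE.
  by move=> -> -> -> ->.
rewrite (cardsD1 set0 (key @: J)) K0; apply: (@leq_ltn_trans (1 + #|key @: J :\ set0| * 2)%N); last by lia.
apply: leq_add z1 _; rewrite -sum_nat_const.
rewrite [leqLHS](eq_bigl [in key @: J :\ set0]); last by move=> K; rewrite !inE andbC.
by apply: leq_sum => K _; rewrite sum1dep_card key_fiber.
Qed.

Lemma shattered_split X : X \in shattered (key @: J) ->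
  exists si sf, [/\ (size si + size sf = #|X|)%N,
    forall s, uniq s -> {subset s <= si ++ sf} -> full_on s, uniq (si ++ sf),
    forall i, i \in si -> int_row i & forall i, i \in sf -> exists t, frac_row t i].
Proof.
move=> H; have [c cP] : exists c : 'I_m -> bool, forall i,
    if c i then int_row i else exists t, frac_row t i.
  suff : forall i, exists b : bool, if b then int_row i else exists t, frac_row t i.
    by move/fin_all_exists.
  by move=> i; case: (rows i) => ?; [exists true | exists false].
pose si := filter c (enum X); pose sf := filter (predC c) (enum X).
have P : perm_eq (si ++ sf) (enum X) by rewrite /si /sf perm_filterC.
exists si, sf; split.
- by rewrite -size_cat (perm_size P) cardE.
- move=> s us ss; apply: shattered_key_full_on H us _ => i /ss.
  by rewrite (perm_mem P) mem_enum.
- by rewrite (perm_uniq P) enum_uniq.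
- by move=> i; rewrite mem_filter => /andP[ci _]; have := cP i; rewrite ci.
- by move=> i; rewrite mem_filter => /andP[/negPf ci _]; have := cP i; rewrite ci.
Qed.

Lemma full_on_int_rows si : (2 < size si)%N -> uniq si ->
  (forall s, uniq s -> {subset s <= si} -> full_on s) ->
  (forall i, i \in si -> int_row i) -> False.
Proof.
case: si => [|a [|b [|c si]]] // _ U H I.
apply: (full_on_int3 Y1 (a := a) (b := b) (c := c) (J := J)).
- move=> d d3 _; apply: H => //; last by move=> i; rewrite !inE => /or3P[]->; rewrite ?orbT.
  by apply: subseq_uniq U; rewrite /= !eqxx sub0seq.
- by apply: I; rewrite !inE eqxx ?orbT.
- by apply: I; rewrite !inE eqxx ?orbT.
- by apply: I; rewrite !inE eqxx ?orbT.
Qed.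

Lemma no_shattered5 X : X \in shattered (key @: J) -> #|X| != 5.
Proof.
move=> XS; apply/eqP=> X5.
have [si [sf [sz H U Ii Ff]]] := shattered_split XS; rewrite X5 in sz.
have [si3|] := ltnP 2 (size si).
  apply: (full_on_int_rows si3 _ _ Ii); first by move: U; rewrite cat_uniq => /and3P[].
  by move=> s us ss; apply: H => // i /ss; rewrite mem_cat => ->.
case: si sz H U Ii => [|u [|v []]] // sz H U Ii _.
(* With at most one integral row, that row or any fractional one heads the list and the order 5 sign
   matrix applies. *)
- case: sf sz H U Ff => [|a s] //= [sz] H U Ff.
  apply: (full_on_frac4 Y1 sz (H (a :: s) U _)) => //.
  by move=> i iS; apply: Ff; rewrite inE iS orbT.
- case: sz => sz; apply: (full_on_frac4 Y1 sz (H (u :: sf) U _)) => //.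
(* With two integral rows, pairing each fractional row with another one forces its parameter to be
   1/2, which leaves the half-integral case. *)
case: sf sz H U Ff => [|r1 [|r2 [|r3 []]]] // _ H U Ff.
have Iu : int_row u by apply: Ii; rewrite inE eqxx.
have Iv : int_row v by apply: Ii; rewrite !inE eqxx orbT.
have [t1 F1] : exists t, frac_row t r1 by apply: Ff; rewrite !inE eqxx.
have [t2 F2] : exists t, frac_row t r2 by apply: Ff; rewrite !inE eqxx ?orbT.
have [t3 F3] : exists t, frac_row t r3 by apply: Ff; rewrite !inE eqxx ?orbT.
have half r r' t t' : uniq [:: u; v; r; r'] -> {subset [:: r; r'] <= [:: r1; r2; r3]} ->
    frac_row t r -> frac_row t' r' -> t = 2^-1.
  move=> U' ss; apply: (full_on_int2_frac2 Y1 _ Iu Iv); apply: H => // i.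
  by rewrite -[_ :: _]/([:: u; v] ++ [:: r; r']) !mem_cat => /orP[->//|/ss->]; rewrite orbT.
have E1 : t1 = 2^-1.
  apply: half F1 F2; first by apply: subseq_uniq U; rewrite /= !eqxx.
  by move=> i; rewrite !inE => /orP[]->; rewrite ?orbT.
have E2 : t2 = 2^-1.
  apply: half F2 F3; last by move=> i; rewrite !inE => /orP[]->; rewrite ?orbT.
  exact: (mask_uniq U [:: true; true; false; true; true]).
have E3 : t3 = 2^-1.
  apply: half F3 F2; last by move=> i; rewrite !inE => /orP[]->; rewrite ?orbT.
  have U' : uniq [:: u; v; r2; r3] := mask_uniq U [:: true; true; false; true; true].
  by rewrite -(perm_uniq (s1 := [:: u; v; r2; r3])) // !perm_cons (perm_catC [:: r2] [:: r3]).
rewrite E1 in F1; rewrite E2 in F2; rewrite E3 in F3.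
by apply: full_on_int2_half3 (H _ U _) Iu Iv F1 F2 F3.
Qed.

Lemma no_shattered4 : (forall t i, frac_row t i -> t != 2^-1) ->
  forall X, X \in shattered (key @: J) -> #|X| != 4.
Proof.
move=> nh X XS; apply/eqP=> X4.
have [si [sf [sz H U Ii Ff]]] := shattered_split XS; rewrite X4 in sz.
have [si3|] := ltnP 2 (size si).
  apply: (full_on_int_rows si3 _ _ Ii); first by move: U; rewrite cat_uniq => /and3P[].
  by move=> s us ss; apply: H => // i /ss; rewrite mem_cat => ->.
case: si sz H U Ii => [|u [|v []]] // sz H U Ii _.
- case: sf sz H U Ff => [|a [|b s]] //= [sz] H U Ff.
  have [t Ft] : exists t, frac_row t b by apply: Ff; rewrite !inE eqxx orbT.
  suff E : t = 2^-1 by have := nh _ _ Ft; rewrite E eqxx.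
  apply: (full_on_frac3 Y1 sz (H [:: a, b & s] U _) _ Ft) => //.
  by move=> i iS; apply: Ff; rewrite !inE iS !orbT.
- case: sf sz H U Ff => [|b s] //= [sz] H U Ff.
  have [t Ft] : exists t, frac_row t b by apply: Ff; rewrite !inE eqxx.
  suff E : t = 2^-1 by have := nh _ _ Ft; rewrite E eqxx.
  apply: (full_on_frac3 Y1 sz (H [:: u, b & s] U _) _ Ft) => //.
  by move=> i iS; apply: Ff; rewrite !inE iS !orbT.
case: sf sz H U Ff => [|r1 [|r2 []]] // _ H U Ff.
have Iu : int_row u by apply: Ii; rewrite inE eqxx.
have Iv : int_row v by apply: Ii; rewrite !inE eqxx orbT.
have [t1 F1] : exists t, frac_row t r1 by apply: Ff; rewrite !inE eqxx.
have [t2 F2] : exists t, frac_row t r2 by apply: Ff; rewrite !inE eqxx ?orbT.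
suff E : t1 = 2^-1 by have := nh _ _ F1; rewrite E eqxx.
by apply: (full_on_int2_frac2 Y1 _ Iu Iv F1 F2); apply: H.
Qed.

Lemma card_class5 : (#|J| <= 2 * \sum_(i < 5) 'C(m, i))%N.
Proof.
apply: leq_trans (card_le_keys) _; rewrite leq_pmul2l //.
by have := sauer_shelah no_shattered5; rewrite card_ord.
Qed.

Lemma card_class4 : (forall t i, frac_row t i -> t != 2^-1) ->
  (#|J| <= 2 * \sum_(i < 4) 'C(m, i))%N.
Proof.
move=> nh; apply: leq_trans (card_le_keys) _; rewrite leq_pmul2l //.
by have := sauer_shelah (no_shattered4 nh); rewrite card_ord.
Qed.

(** No 3-set is shattered even with [set0] added to the keys, so the bound is 2 (1 + m + m (m - 1) /
    2) - 1. *)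
Lemma card_class_int : (forall i, int_row i) -> (#|J| <= m ^ 2 + m + 1)%N.
Proof.
move=> I; have := card_le_keys_int I.
have : (#|set0 |: key @: J| <= \sum_(i < 3) 'C(m, i))%N.
  have := @sauer_shelah _ (set0 |: key @: J) 3; rewrite card_ord; apply=> X XS; apply/eqP => X3.
  have X3' : size (enum X) = 3 by rewrite -cardE.
  case E : (enum X) X3' => [|a [|b [|c []]]] // _.
  apply: (full_on_int3 Y1 (a := a) (b := b) (c := c) (J := J)) => // d d3 hd.
  have [||K] := shattered_full_on XS (s := [:: a; b; c]) (b := d) _ _ d3.
  - by rewrite -E enum_uniq.
  - by move=> i; rewrite -E mem_enum.
  rewrite in_setU1 => /orP[/eqP->|/imsetP[j jJ ->]] Ed.
    by rewrite -Ed /= !inE in hd.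
  by exists j => //; rewrite -Ed; apply: eq_map => i; rewrite inE.
have := mul_bin_left m 1; rewrite !big_ord_recr big_ord0 /= bin0 bin1; nia.
Qed.
End Class.

(** * Coordinates in a maximal basis *)

Lemma absz_det_row_perm p (s : 'S_p) (M : 'M[int]_p) :
  `|\det (row_perm s M)|%N = `|\det M|%N.
Proof. by rewrite row_permE det_mulmx det_perm abszMsign. Qed.

Lemma absz_det_col_perm p (s : 'S_p) (M : 'M[int]_p) :
  `|\det (col_perm s M)|%N = `|\det M|%N.
Proof. by rewrite col_permE det_mulmx det_perm mulrC abszMsign. Qed.

Lemma strinc_inj k p (f : {ffun 'I_k -> 'I_p}) : strinc f -> injective f.
Proof.
move=> /forallP H i j fij; apply: val_inj; case: (ltngtP i j) => // ij.
  by have /forallP/(_ j)/implyP/(_ ij) := H i; rewrite fij ltnn.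
by have /forallP/(_ i)/implyP/(_ ij) := H j; rewrite fij ltnn.
Qed.

(** A repeated column gives determinant 0; otherwise sorting the column indices changes only the
    sign. *)
Lemma det_colsub_le m n (A : 'M[int]_(m, n)) (h : 'I_m -> 'I_n) :
  (`|\det (colsub h A)| <= Delta_k m A)%N.
Proof.
have [/injectiveP hi|/injectivePn[i [j ij hij]]] := boolP (injectiveb h); last first.
  rewrite -det_tr (determinant_alternate ij) ?absz0 // => k.
  by rewrite !mxE hij.
pose t := [tuple h i | i < m].
have srt : size (sort (relpre val leq) t) == m by rewrite size_sort size_tuple.
have [s sP] : exists s : 'S_m, sort (relpre val leq) t = [tuple tnth t (s i) | i < m].
  by apply/tuple_permP; rewrite perm_sort.
pose g := [ffun i => h (s i)].
have gs : strinc g.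
  apply/forallP=> i; apply/forallP=> j; apply/implyP=> ij.
  have : sorted (relpre val leq) [tuple tnth t (s i) | i < m].
    by rewrite -sP sort_sorted // => x y /=; apply: leq_total.
  move=> S; have := sorted_ltn_nth _ (h i) S.
  move/(_ (fun x y z => @leq_trans _ _ _) i j).
  rewrite !inE size_tuple !ltn_ord => /(_ isT isT ij).
  rewrite -!tnth_nth !tnth_mktuple !ffunE /= leq_eqVlt => /orP[/eqP/val_inj/hi/perm_inj E|//].
  by rewrite E ltnn in ij.
have : strinc [ffun i : 'I_m => i].
  by apply/forallP=> i; apply/forallP=> j; apply/implyP=> ij; rewrite !ffunE.
move=> fs; apply: leq_trans (leq_bigmax_cond _ fs).
apply: leq_trans (leq_bigmax_cond _ gs).
rewrite -(absz_det_col_perm s); apply: eq_leq; congr `|\det _|%N.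
by apply/matrixP=> i j; rewrite !mxE !ffunE.
Qed.

Lemma bigmax_attained (I : finType) (P : pred I) (F : I -> nat) :
  (0 < \max_(i | P i) F i)%N -> exists2 i, P i & F i = \max_(i | P i) F i.
Proof.
have [i Pi _|P0] := pickP P; last by rewrite big_pred0.
have [|j Pj ->] := @eq_bigmax_cond _ P F; first by apply/card_gt0P; exists i.
by exists j.
Qed.

Lemma Delta_k_attained m n (A : 'M[int]_(m, n)) : (0 < Delta_k m A)%N ->
  exists h, `|\det (colsub h A)|%N = Delta_k m A.
Proof.
move=> D0; have [f fs Ef] := bigmax_attained D0.
rewrite -[Delta_k _ _]Ef in D0 *; have [g gs Eg] := bigmax_attained D0.
exists g; rewrite -Eg -(absz_det_row_perm (perm (strinc_inj fs))).
by congr `|\det _|%N; apply/matrixP=> i j; rewrite !mxE permE.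
Qed.

(** Columns outside the image of [f] are unit vectors and are expanded away one by one. When [f] is
    onto, rows and columns undergo the same permutation and the signs cancel. *)
Lemma det_principal (R : comNzRingType) k p (f : 'I_k -> 'I_p) (N : 'M[R]_p) :
  injective f -> (forall i r, i \notin codom f -> N r i = (r == i)%:R) ->
  \det N = \det (mxsub f f N).
Proof.
elim: p f N => [|p IH] f N fi Ne.
  case: k f fi Ne => [|k] f fi Ne; first by rewrite !det_mx00.
  by case: (f ord0).
have [i ni|allf] := pickP (fun i => i \notin codom f); last first.
  have kp : k = p.+1.
    have := card_codom fi; rewrite card_ord => <-.
    rewrite -[RHS](card_ord p.+1); apply: eq_card => i.
    by have /negbFE -> := allf i.
  subst k; pose s := perm fi.
  have -> : mxsub f f N = row_perm s (col_perm s N).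
    by apply/matrixP=> a b; rewrite !mxE !permE.
  rewrite row_permE col_permE !det_mulmx !det_perm mulrCA -signr_addb odd_permV.
  by rewrite addbb mulr1.
have [f' f'P] : exists f' : 'I_k -> 'I_p, forall a, f a = lift i (f' a).
  suff : forall a, exists b, f a = lift i b by move/fin_all_exists.
  move=> a; case: (unliftP i (f a)) => [b ->|E]; first by exists b.
  by rewrite -E codom_f in ni.
rewrite (expand_det_col _ i) (bigD1 i) //= big1 ?addr0; last first.
  by move=> r ri; rewrite Ne // (negPf ri) mul0r.
rewrite Ne // eqxx mul1r /cofactor -signr_odd oddD addbb mul1r.
rewrite (IH f').
- by congr (\det _); apply/matrixP=> a b; rewrite !mxE !f'P.
- by move=> a b E; apply: fi; rewrite !f'P E.
move=> a r na; rewrite !mxE Ne ?(inj_eq lift_inj) //.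
by apply: contra na => /codomP[b]; rewrite f'P => /lift_inj->; apply: codom_f.
Qed.

(** In Smith form B = L D V, the label of a is the vector of residues of L^-1 a modulo the diagonal
    of D, whose product is det B up to sign. *)
Lemma coset_labelling m (B : 'M[int]_m) : \det B != 0 ->
  exists (T : finType) (c : 'cV[int]_m -> T), #|T| = `|\det B|%N /\
    forall a b, c a = c b -> exists z, a - b = B *m z.
Proof.
move=> dB; have [L uL [V uV [d _ E]]] := int_Smith_normal_form B.
have det_unit p (M : 'M[int]_p) : M \in unitmx -> `|\det M|%N = 1%N.
  by rewrite unitmxE => /orP[]/eqP->.
pose e (i : 'I_m) := d`_i; pose D : 'M[int]_m := diag_mx (\row_i e i).
have {}E : B = L *m D *m V.
  by rewrite E; congr (_ *m _ *m _); apply/matrixP=> i j; rewrite !mxE val_eqE.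
have detB : `|\det B|%N = (\prod_(i < m) `|e i|)%N.
  rewrite E !det_mulmx !abszM (det_unit _ L uL) (det_unit _ V uV) mul1n muln1 det_diag.
  rewrite (big_morph absz abszM (erefl : absz 1 = 1%N)).
  by apply: eq_bigr => i _; rewrite mxE.
have d0 i : e i != 0.
  apply: contraNneq dB => di0; rewrite -absz_eq0 detB (bigD1 i) //= di0.
  by rewrite mul0n.
have ltd i x : (`|(x %% e i)%Z| < `|e i|)%N.
  by rewrite -ltz_nat abszE ger0_norm ?modz_ge0 // ltz_mod.
pose c (a : 'cV[int]_m) : {dffun forall i : 'I_m, 'I_`|e i|} :=
  [ffun i => Ordinal (ltd i ((invmx L *m a) i 0))].
exists {dffun forall i : 'I_m, 'I_`|e i|}, c; split.
  rewrite detB card_dep_ffun foldrE big_map big_enum /=.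
  by apply: eq_bigr => i _; rewrite card_ord.
move=> a b cab.
have [q qP] : exists q : 'I_m -> int, forall i, (invmx L *m (a - b)) i 0 = q i * e i.
  suff : forall i, exists q, (invmx L *m (a - b)) i 0 = q * e i by move/fin_all_exists.
  move=> i; apply/dvdzP; rewrite mulmxBr mxE [X in _ + X]mxE -eqz_mod_dvd.
  have /ffunP/(_ i) := cab; rewrite !ffunE => -[/(congr1 Posz)].
  by rewrite !gez0_abs ?modz_ge0 // => ->.
exists (invmx V *m \col_i q i); rewrite E -!mulmxA mulKVmx //.
rewrite -[LHS](mulKVmx uL); congr (_ *m _); apply/colP=> i.
by rewrite qP mul_diag_mx !mxE mulrC.
Qed.

Lemma int_entry (R : realFieldType) (x : R) (z : int) : `|x| <= 1 -> x = z%:~R ->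
  if bit x then sgn x else x = 0.
Proof.
move=> x1 xz; have {x1} : (`|z| <= 1)%N by rewrite -lez_nat abszE -(ler_int R) intr_norm -xz.
rewrite {x}xz /bit /sgn; case: z => [[|[|z]]|[|z]] // _.
- by rewrite ltxx /= eq_sym oppr_eq0 oner_eq0.
- by rewrite ltr01; left.
- by rewrite NegzE mulrN1z eqxx orbT; right.
Qed.

Lemma frac_eq (R : realFieldType) (s t : R) (z : int) :
  0 < s < 1 -> 0 < t < 1 -> s - t = z%:~R -> s = t.
Proof.
move=> /andP[s0 s1] /andP[t0 t1] E; apply/eqP; rewrite -subr_eq0 E intr_eq0.
have : (z%:~R < 1%:~R :> R) by rewrite -E; lra.
have : ((-1)%:~R < z%:~R :> R) by rewrite -E mulrN1z; lra.
by rewrite !ltr_int; lia.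
Qed.

(** Entries of one row over [J] agree modulo 1, so all or none are integers. If none are, they lie
    strictly between -1 and 1 and share a fractional part t. *)
Lemma row_type m n (Y : 'M[rat]_(m, n)) (J : {set 'I_n}) i :
  (forall j, `|Y i j| <= 1) ->
  (forall j k, j \in J -> k \in J -> exists z : int, Y i j = Y i k + z%:~R) ->
  int_row Y J i \/ exists t, frac_row Y J t i.
Proof.
move=> Y1 JZ; have [->|[j0 j0J]] := set_0Vmem J; first by left=> j; rewrite inE.
have [/intrP[z0 E0]|nint] := boolP (Y i j0 \is a Num.int).
  left=> j jJ; have [z E] := JZ _ _ jJ j0J.
  by apply: (@int_entry _ _ (z0 + z)) => //; rewrite E E0 intrD.
have ni j : j \in J -> Y i j \isn't a Num.int.
  by move=> jJ; have [z ->] := JZ _ _ jJ j0J; rewrite rpredDr ?intr_int.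
have bnd j : j \in J -> [/\ -1 < Y i j, Y i j < 1 & Y i j != 0].
  move=> jJ; have := Y1 j; rewrite ler_norml => /andP[l u]; split.
  - by rewrite lt_def l andbT; apply: contraNneq (ni _ jJ) => ->; rewrite rpredN1.
  - by rewrite lt_def u andbT; apply: contraNneq (ni _ jJ) => <-; rewrite rpred1.
  - by apply: contraNneq (ni _ jJ) => ->; rewrite rpred0.
have bitE j : j \in J -> bit (Y i j) = (0 < Y i j).
  by case/bnd=> l _ _; rewrite /bit orbC; case: eqP l => // ->; rewrite ltxx.
pose s j := if bit (Y i j) then Y i j else Y i j + 1.
have s01 j : j \in J -> 0 < s j < 1.
  move=> jJ; have [l u z] := bnd _ jJ; rewrite /s bitE //; case: (ltrP 0 (Y i j)) => h.
    by apply/andP; split.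
  have h' : Y i j < 0 by rewrite lt_neqAle z h.
  by apply/andP; split; lra.
right; exists (s j0); split; first exact: s01.
move=> j jJ; have [z E] := JZ _ _ jJ j0J.
suff <- : s j = s j0 by rewrite /s; case: (bit (Y i j)); rewrite ?addrK.
have sz k : exists w : int, s k = Y i k + w%:~R.
  by rewrite /s; case: ifP => _; [exists 0; rewrite addr0 | exists 1].
have [w Ew] := sz j; have [w0 Ew0] := sz j0.
apply: (@frac_eq _ _ _ (z + w - w0)); try exact: s01.
by rewrite Ew Ew0 E !intrD mulrNz; ring.
Qed.

(** * Reduction to cosets of the lattice of a maximal submatrix *)

Section Reduction.
Variables (m n : nat) (A : 'M[int]_(m, n)) (h : 'I_m -> 'I_n).
Hypothesis D0 : (0 < Delta_k m A)%N.
Hypothesis hD : `|\det (colsub h A)|%N = Delta_k m A.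
Hypothesis distA : distinct_cols A.

Notation toQ := (map_mx (intmul 1 : int -> rat)).
Let B := colsub h A.
Definition coords : 'M[rat]_(m, n) := invmx (toQ B) *m toQ A.
Let Y := coords.

Let detB : \det B != 0.
Proof. by rewrite -absz_eq0 hD -lt0n. Qed.

Let unitB : toQ B \in unitmx.
Proof. by rewrite unitmxE unitfE det_map_mx intr_eq0. Qed.

Lemma coords_lattice j (a : 'cV[int]_m) z : col j A = a + B *m z ->
  forall i, Y i j = (invmx (toQ B) *m toQ a) i 0 + (z i 0)%:~R.
Proof.
move=> E i; have -> : Y i j = (invmx (toQ B) *m toQ (col j A)) i 0.
  by rewrite !mxE; apply: eq_bigr => k _; rewrite !mxE.
by rewrite E map_mxD map_mxM /= mulmxDr mulKmx // mxE [X in _ + X = _]mxE.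
Qed.

Lemma coords_minors : minors_le1 Y.
Proof.
move=> k f g; have [/injectiveP fi|/injectivePn[a [b ab fab]]] := boolP (injectiveb f); last first.
  rewrite (determinant_alternate ab) ?normr0 // => j.
  by rewrite !mxE fab.
(* Completing the chosen columns by identity columns turns the k x k minor into an m x m one, namely
   the quotient of a maximal minor of [A] by det B. Maximality of |det B| bounds it. *)
pose h' i := if [pick a | f a == i] is Some a then g a else h i.
have h'f a : h' (f a) = g a.
  by rewrite /h'; case: pickP => [b /eqP/fi->//|/(_ a)]; rewrite eqxx.
have h'n i : i \notin codom f -> h' i = h i.
  rewrite /h'; case: pickP => [b /eqP<-|//]; by rewrite codom_f.
have -> : mxsub f g Y = mxsub f f (colsub h' Y).
  by apply/matrixP=> i j; rewrite !mxE h'f.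
rewrite -det_principal //; last first.
  move=> i r /h'n E; have -> : colsub h' Y r i = colsub h Y r i by rewrite !mxE E.
  have -> : colsub h Y = 1%:M.
    rewrite -mulmx_colsub -[RHS](mulVmx unitB); congr (_ *m _).
    by apply/matrixP=> a b; rewrite !mxE.
  by rewrite mxE.
rewrite -mulmx_colsub det_mulmx det_inv normrM normrV ?unitfE ?normr_eq0; last first.
  by rewrite det_map_mx intr_eq0.
have -> : colsub h' (toQ A) = toQ (colsub h' A) by apply/matrixP=> a b; rewrite !mxE.
rewrite !det_map_mx -!intr_norm mulrC ler_pdivrMr ?ltr0z ?normr_gt0 // mul1r ler_int.
by rewrite -!abszE lez_nat hD det_colsub_le.
Qed.

Lemma coords_inj j k : (forall i, Y i j = Y i k) -> j = k.
Proof.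
move=> E; apply: distA; apply/colP=> i; rewrite !mxE; apply: (@intr_inj rat).
have EA : toQ A = toQ B *m Y by rewrite mulKVmx.
have Q l : (A i l)%:~R = (toQ A) i l by rewrite mxE.
by rewrite !Q EA !mxE; apply: eq_bigr => l _; rewrite E.
Qed.

Lemma coords_le1 i j : `|Y i j| <= 1.
Proof.
have := coords_minors (fun _ : 'I_1 => i) (fun _ => j).
by rewrite det_mx11 mxE.
Qed.

(** Cramer's rule, with the adjugate as integral numerator. *)
Lemma det_coords_int i j : exists z : int, (\det B)%:~R * Y i j = z%:~R.
Proof.
exists ((\adj B *m A) i j).
transitivity (((\det B)%:~R *: Y) i j); first by rewrite [RHS]mxE.
rewrite -det_map_mx -mul_scalar_mx -mul_adj_mx -mulmxA mulKVmx //.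
by rewrite -map_mx_adj -map_mxM mxE.
Qed.


Lemma coset_class_bounds (J : {set 'I_n}) :
  (forall j k, j \in J -> k \in J -> exists z, col j A - col k A = B *m z) ->
  (#|J| <= 2 * \sum_(i < 5) 'C(m, i))%N /\
  (odd (Delta_k m A) -> (#|J| <= 2 * \sum_(i < 4) 'C(m, i))%N).
Proof.
move=> JB; have rows i : int_row Y J i \/ exists t, frac_row Y J t i.
  apply: row_type => [j|j k jJ kJ]; first exact: coords_le1.
  have [z E] := JB _ _ jJ kJ; exists (z i 0).
  have /coords_lattice/(_ i) -> : col j A = col k A + B *m z by rewrite -E addrC subrK.
  congr (_ + _); rewrite !mxE; apply: eq_bigr => l _; by rewrite !mxE.
have dist j k : j \in J -> k \in J -> (forall i, Y i j = Y i k) -> j = k.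
  by move=> _ _; apply: coords_inj.
split; first exact: card_class5 coords_minors rows dist.
move=> oD; have [->|[j jJ]] := set_0Vmem J; first by rewrite cards0.
(* If t were 1/2, some entry of [Y] would be +-1/2; as det B times it is an integer, det B would be
   even. *)
apply: (card_class4 coords_minors rows dist) => t i [_ /(_ j jJ) F].
apply/eqP=> th; have [z Ez] := det_coords_int i j.
suff : \det B = z *+ 2 \/ - \det B = z *+ 2.
  by have : odd `|\det B| by [rewrite hD]; rewrite mulr2n; lia.
have E2 : (\det B)%:~R = 2 * z%:~R :> rat \/ - (\det B)%:~R = 2 * z%:~R :> rat.
  by rewrite -Ez; move: F; rewrite -/Y th; case: ifP => _ ->; [left | right]; lra.
case: E2 => E; [left | right]; apply: (@intr_inj rat);
  rewrite ?mulrNz E mulr2n intrD; ring.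
Qed.

Lemma integral_class_bound (J : {set 'I_n}) :
  (forall j, j \in J -> exists z, col j A = B *m z) -> (#|J| <= m ^ 2 + m + 1)%N.
Proof.
move=> JB; have I i : int_row Y J i.
  move=> j /JB[z E]; apply: (@int_entry _ _ (z i 0)); first exact: coords_le1.
  rewrite -[B *m z]add0r in E; rewrite (coords_lattice E).
  by rewrite map_mx0 mulmx0 mxE add0r.
apply: (card_class_int coords_minors) => //; first by left.
by move=> j k _ _; apply: coords_inj.
Qed.

(** The lattice itself, labelled [lab 0], gets the sharper integral bound; each of the other Delta -
    1 labels contributes at most 2c columns. *)
Lemma columns_bound c :
  (forall J : {set 'I_n},
     (forall j k, j \in J -> k \in J -> exists z, col j A - col k A = B *m z) ->
     (#|J| <= 2 * c)%N) ->
  (n <= m ^ 2 + m + 1 + 2 * (Delta_k m A - 1) * c)%N.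
Proof.
move=> cb; have [T [lab [cT labP]]] := coset_labelling detB.
rewrite -[n in (n <= _)%N]card_ord -sum1_card.
rewrite (partition_big (fun j => lab (col j A)) xpredT) //= (bigD1 (lab 0)) //=.
apply: leq_add.
  rewrite sum1dep_card; apply: integral_class_bound => j; rewrite inE => /eqP/labP[z].
  by rewrite subr0; exists z.
have -> : (2 * (Delta_k m A - 1) * c = \sum_(l | l != lab 0%R) 2 * c)%N.
  by rewrite sum_nat_const (cardC1 (lab 0)) cT hD -subn1; lia.
apply: leq_sum => l _; rewrite sum1dep_card; apply: cb => j k.
by rewrite !inE => /eqP jl /eqP kl; apply: labP; rewrite jl kl.
Qed.
End Reduction.

Theorem theorem1p2 (Delta m : nat) (hD : (0 < Delta)%N) (hm : (0 < m)%N) :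
  ((5 <= m)%N ->
     forall (n : nat) (A : 'M[int]_(m, n)),
       distinct_cols A -> Delta_k m A = Delta ->
       (n <= m ^ 2 + m + 1 + 2 * (Delta - 1) * \sum_(i < 5) 'C(m, i))%N)
  /\
  ((4 <= m)%N -> odd Delta ->
     forall (n : nat) (A : 'M[int]_(m, n)),
       distinct_cols A -> Delta_k m A = Delta ->
       (n <= m ^ 2 + m + 1 + 2 * (Delta - 1) * \sum_(i < 4) 'C(m, i))%N).
Proof.
split=> [_|_ oD] n A dA ED; rewrite -ED in hD *;
  have [h hA] := Delta_k_attained hD; apply: (columns_bound hD hA dA) => J JB.
  by case: (coset_class_bounds hD hA dA JB).
by case: (coset_class_bounds hD hA dA JB) => _; apply; rewrite ED.
Qed.
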